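(* Let $R=\bigoplus_{n\ge0}R_n$ be a reduced, finitely generated $\mathbb{N}$-graded algebra over a field $R_0=\mathbb{F}$ of characteristic $p>0$, of positive Krull dimension, and locally equidimensional. Let $R_+=\bigoplus_{n>0}R_n$. Let $y_1,\dots,y_s$ be homogeneous $R_0$-algebra generators of $R$ of degrees $\beta_1,\dots,\beta_s$, and set $\beta'=\min_i\beta_i$. Let $\mathfrak{a}$ be a homogeneous $R_+$-primary ideal and let $l\le k$ be integers with $R_+^k\subset\mathfrak{a}\subset R_+^l$. Let $I=(f_1,\dots,f_d)$ where $f_1,\dots,f_d$ is a homogeneous system of parameters of $R$, let $t\in\mathbb{R}_{>0}$, and set $N=\sum_{i=1}^d\deg f_i-t\beta' l$. Suppose $R$ has a parameter test element. If $x\in R_{\ge N}$, then $x\in I^{*\mathfrak{a}^t}$. In other words, $R_{\ge N}+I^{F\mathfrak{a}^t}\subset I^{*\mathfrak{a}^t}$.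
   Context: All rings are commutative with unit and noetherian. $R^\circ$ is the set of elements of $R$ not in any minimal prime of $R$. For $N\in\mathbb{R}$, $R_{\ge N}$ is the $R_0$-submodule of $R$ generated by homogeneous elements of degree at least $N$. $I^{[p^e]}$ is the ideal generated by $\{r^{p^e}\mid r\in I\}$. Tight closure: $\mathfrak{q}^*=\{x\in R\mid\text{for some }c\in R^\circ\text{ and all }e\gg0,\ cx^{p^e}\in\mathfrak{q}^{[p^e]}\}$. An element $c\in R^\circ$ is a parameter test element if, for all $e\ge0$ and all ideals $\mathfrak{q}$ generated by a system of parameters of $R$, $c(\mathfrak{q}^* )^{[p^e]}\subset\mathfrak{q}^{[p^e]}$. Further, $$I^{*\mathfrak{a}^t}=\{x\in R\mid\text{for some }c\in R^\circ\text{ and all }e\gg0,\ cx^{p^e}\mathfrak{a}^{\lceil tp^e\rceil}\subset I^{[p^e]}\},$$ $$I^{F\mathfrak{a}^t}=\{x\in R\mid\text{for all }e\gg0,\ x^{p^e}\mathfrak{a}^{\lceil tp^e\rceil}\subset I^{[p^e]}\}.$$ *)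

(* Defs.v *)
From mathcomp Require Export all_boot all_order all_algebra.
From mathcomp Require Export all_classical all_reals.

Set Implicit Arguments.
Unset Strict Implicit.
Unset Printing Implicit Defensive.

Import Order.TTheory GRing.Theory Num.Theory.

Local Open Scope classical_set_scope.
Local Open Scope ring_scope.

Section Ideals.
Variable R : comNzRingType.
Implicit Types (I J P Q : set R) (X : set (set R)).

(* Possibly improper ideals, i.e. R-submodules of R; the library predicate
   [idealr_closed] only covers proper ideals. *)
Definition is_ideal I : Prop := GRing.submod_closed (mem (I : set R^o)).

Definition ideal_gen (S : set R) : set R := smallest is_ideal S.

Definition ideal_mul I J : set R := ideal_gen [set a * b | a in I & b in J].

Definition ideal_exp I (n : nat) : set R := iter n (ideal_mul I) setT.

Definition ideal_radical I : set R := [set x | exists n : nat, I (x ^+ n)].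

Definition primary_ideal I : Prop :=
  [/\ is_ideal I, ~ I 1 &
      forall x y, I (x * y) -> I x \/ ideal_radical I y].

Definition prime_ideal P : Prop :=
  idealr_closed (mem P) /\ prime_idealr_closed (mem P).

Definition minimal_prime P : Prop :=
  prime_ideal P /\ forall Q, prime_ideal Q -> Q `<=` P -> Q = P.

(* The set written R° in the literature. *)
Definition off_minimal_primes : set R :=
  [set c | forall P, minimal_prime P -> ~ P c].

Definition noetherian_ring : Prop :=
  forall I, is_ideal I ->
    exists (n : nat) (g : 'I_n -> R), I = ideal_gen (range g).

Definition reduced_ring : Prop :=
  forall (x : R) (n : nat), x ^+ n = 0 -> x = 0.

(* [X] contains a chain c 0 < c 1 < ... < c n (only these n + 1 values of c
   are relevant). *)
Definition has_chain X (n : nat) : Prop :=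
  exists c : nat -> set R,
    (forall i, (i <= n)%N -> X (c i)) /\
    (forall i, (i < n)%N -> c i `<` c i.+1).

(* n is the supremum of the lengths of the chains in [X]. *)
Definition chain_dim X (n : nat) : Prop :=
  has_chain X n /\ ~ has_chain X n.+1.

Definition krull_dim (n : nat) : Prop := chain_dim prime_ideal n.

(* dim R/I; in particular R/I is nonzero. *)
Definition krull_dim_quot I (n : nat) : Prop :=
  chain_dim [set P | prime_ideal P /\ I `<=` P] n.

(* Every local ring R_P is equidimensional: dim R_P/QR_P = dim R_P for every
   minimal prime Q of R contained in P. The spectra of R_P and of R_P/QR_P are
   identified with the corresponding sets of primes of R. *)
Definition locally_equidimensional : Prop :=
  forall P Q, prime_ideal P -> minimal_prime Q -> Q `<=` P ->
  forall n, chain_dim [set P' | prime_ideal P' /\ P' `<=` P] n <->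
            chain_dim [set P' | [/\ prime_ideal P', Q `<=` P' & P' `<=` P]] n.

(* d = dim R elements such that R/(f) has dimension 0. *)
Definition system_of_parameters (d : nat) (f : 'I_d -> R) : Prop :=
  krull_dim d /\ krull_dim_quot (ideal_gen (range f)) 0.

End Ideals.

Section TightClosure.
Variables (R : comNzRingType) (p : nat).
Implicit Types (I q a : set R).

(* I^[p^e] *)
Definition frobenius_power I (e : nat) : set R :=
  ideal_gen [set r ^+ (p ^ e) | r in I].

Definition tight_closure q : set R :=
  [set x | exists2 c : R, off_minimal_primes c &
    exists e0 : nat, forall e, (e0 <= e)%N ->
      frobenius_power q e (c * x ^+ (p ^ e))].

Definition parameter_test_element (c : R) : Prop :=
  off_minimal_primes c /\
  forall (e d : nat) (f : 'I_d -> R), system_of_parameters f ->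
    let q := ideal_gen (range f) in
    forall z, frobenius_power (tight_closure q) e z ->
      frobenius_power q e (c * z).

Section Exponent.
Variables (K : realType) (a : set R) (t : K).

(* The ideal a^{ceil(t p^e)}; the exponent is meant for t >= 0. *)
Definition frobenius_exp (e : nat) : set R :=
  ideal_exp a `|Num.ceil (t * (p ^ e)%:R)|%N.

(* I^{* a^t} *)
Definition a_tight_closure I : set R :=
  [set x | exists2 c : R, off_minimal_primes c &
    exists e0 : nat, forall e, (e0 <= e)%N ->
      forall z, frobenius_exp e z ->
        frobenius_power I e (c * x ^+ (p ^ e) * z)].

(* I^{F a^t} *)
Definition a_frobenius_closure I : set R :=
  [set x | exists e0 : nat, forall e, (e0 <= e)%N ->
      forall z, frobenius_exp e z ->
        frobenius_power I e (x ^+ (p ^ e) * z)].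

End Exponent.
End TightClosure.

Section Graded.
Variables (F : fieldType) (R : comAlgType F) (G : nat -> set R).

(* R is the internal direct sum of the G n, as an N-graded ring with
   G 0 = F. *)
Definition is_grading : Prop :=
  [/\ G 0%N = range (fun u : F => u%:A),
      forall n, GRing.submod_closed (mem (G n)),
      forall m n x y, G m x -> G n y -> G (m + n)%N (x * y),
      forall x, exists (m : nat) (c : nat -> R),
        (forall i, G i (c i)) /\ x = \sum_(i < m) c i &
      forall (m : nat) (c : nat -> R), (forall i, G i (c i)) ->
        \sum_(i < m) c i = 0 -> forall i, (i < m)%N -> c i = 0].

(* The F-submodule generated by the homogeneous elements with degree in D. *)
Definition degrees_in (D : set nat) : set R :=
  smallest (fun M : set R => GRing.submod_closed (mem M))
    (\bigcup_(n in D) G n).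

Definition irrelevant_ideal : set R := degrees_in [set n | (0 < n)%N].

Definition degrees_ge (K : realType) (N : K) : set R :=
  degrees_in [set n | N <= n%:R].

Definition homogeneous_ideal (I : set R) : Prop :=
  exists2 S : set R, S `<=` \bigcup_n G n & I = ideal_gen S.

Definition algebra_generators (s : nat) (y : 'I_s -> R) : Prop :=
  smallest (fun A : set R => GRing.subalg_closed (mem A)) (range y) = setT.

End Graded.

(* Main.v *)
Require Import Defs.

Set Implicit Arguments.
Unset Strict Implicit.
Unset Printing Implicit Defensive.

Import Order.TTheory GRing.Theory Num.Theory.

Local Open Scope classical_set_scope.
Local Open Scope ring_scope.

(** Write q = p^e, D for the sum of the degrees of the f_i, and R_{>= r} for
    [degrees_ge G r]. The theorem comes down to counting degrees. If x lies in
    R_{>= N} and z lies in a^ceil(t q), then x^q has order at least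
    q (D - t beta' l), and z has order at least t q beta' l, because every
    element of R_+ has order at least beta'
    ([irrelevant_ideal_min_degree]). Hence x^q z lies in R_{>= q D}.

    High degrees are absorbed by powers of parameters. Modulo (f) only finitely
    many degrees survive, say those below B ([sop_contains_high_degrees]).
    Rewriting an element of degree n >= B as a combination of the f_i, and then
    its coefficients as long as their degrees are at least B, produces monomials
    in the f_i; once n >= B + (q - 1) D, each of them is divisible by some
    f_i^q ([pure_powers_contain]). So R_{>= B + q D} is contained in I^[q], and
    any c in R° of order at least B satisfies c x^q z in I^[q] for all e and z
    at once.

    It remains to find such a c. As dim R > 0, the ideal R_+ is nonzero, and as
    R is reduced, R_+ then has no nonzero annihilator; a noetherian argument
    extracts a nonzerodivisor c0 from it ([nonzerodivisor_of_positive_degree]).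
    A nonzerodivisor avoids all minimal primes
    ([nonzerodivisor_off_minimal_primes]), so c0^B serves as c.

    The Frobenius-closure part follows from additivity of the p^e-th power. *)

(** * Ideals of noetherian rings *)

Section IdealTheory.
Variable R : comNzRingType.
Implicit Types (I J P Q S : set R) (a u v x y : R).

Lemma is_idealE I :
  is_ideal I <-> I 0 /\ forall a u v, I u -> I v -> I (a * u + v).
Proof.
split=> -[h0 h]; split; rewrite ?in_setE in h0 *; rewrite ?inE //.
  by move=> a u v hu hv; have := h a u v; rewrite !inE; apply.
by move=> a u v; rewrite !inE; apply: h.
Qed.

Lemma ideal0 I : is_ideal I -> I 0.
Proof. by case/is_idealE. Qed.

Lemma idealD I u v : is_ideal I -> I u -> I v -> I (u + v).
Proof. by case/is_idealE=> _ h hu hv; rewrite -[u]mul1r; apply: h. Qed.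

Lemma idealMl I a u : is_ideal I -> I u -> I (a * u).
Proof. by case/is_idealE=> h0 h hu; rewrite -[_ * _]addr0; apply: h. Qed.

Lemma idealMr I a u : is_ideal I -> I u -> I (u * a).
Proof. by rewrite mulrC; apply: idealMl. Qed.

Lemma ideal_sum I n (h : 'I_n -> R) :
  is_ideal I -> (forall i, I (h i)) -> I (\sum_(i < n) h i).
Proof.
move=> hI hh; apply: big_ind => //; first exact: ideal0.
by move=> x y; apply: idealD.
Qed.

Lemma ideal_gen_ideal S : is_ideal (ideal_gen S).
Proof.
apply/is_idealE; split=> [M [hM _]|a u v hu hv M [hM hS]]; first exact: ideal0.
by apply: idealD => //; [apply: idealMl => //; apply: hu|apply: hv].
Qed.

Lemma ideal_gen_range_id n (g : 'I_n -> R) i : ideal_gen (range g) (g i).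
Proof. by apply: sub_gen_smallest; exists i. Qed.

Lemma ideal_gen_rangeP n (g : 'I_n -> R) x :
  ideal_gen (range g) x -> exists r : 'I_n -> R, x = \sum_(i < n) r i * g i.
Proof.
pose M := [set x | exists r : 'I_n -> R, x = \sum_(i < n) r i * g i].
apply: (smallest_sub (X := M)).
  apply/is_idealE; split.
    by exists (fun=> 0); rewrite big1 // => i _; rewrite mul0r.
  move=> a _ _ [r ->] [r' ->]; exists (fun i => a * r i + r' i).
  rewrite mulr_sumr -big_split; apply: eq_bigr => i _ /=.
  by rewrite mulrDl mulrA.
move=> _ [i _ <-]; exists (fun j => (j == i)%:R).
rewrite (bigD1 i) //= eqxx mul1r big1 ?addr0 // => j /negbTE ->.
by rewrite mul0r.
Qed.

Lemma prime_ideal_is_ideal P : prime_ideal P -> is_ideal P.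
Proof.
case=> -[h0 _ h] _; apply/is_idealE; rewrite in_setE in h0; split=> // a u v.
by have := h a u v; rewrite !in_setE.
Qed.

Lemma prime_ideal_proper P : prime_ideal P -> ~ P 1.
Proof. by case=> -[_ /negP h _] _ h1; apply: h; rewrite in_setE. Qed.

Lemma prime_idealM P x y : prime_ideal P -> P (x * y) -> P x \/ P y.
Proof.
case=> _ h hxy; have := h x y; rewrite in_setE => /(_ hxy) /orP.
by rewrite !in_setE.
Qed.

Lemma prime_idealI P :
  is_ideal P -> ~ P 1 -> (forall x y, P (x * y) -> P x \/ P y) ->
  prime_ideal P.
Proof.
move=> /is_idealE[h0 h] h1 hM; split; [split|].
- by rewrite in_setE.
- by apply/negP; rewrite in_setE.
- by move=> a u v; rewrite !in_setE; apply: h.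
- move=> u v; rewrite in_setE => /hM huv; apply/orP.
  by rewrite !in_setE.
Qed.

(** Zorn's lemma applies because the union of a chain of ideals is finitely
    generated, hence already equal to a member of the chain. *)
Lemma noetherian_maximal (Phi : set (set R)) J :
  noetherian_ring R -> Phi `<=` @is_ideal R -> Phi J ->
  exists2 M, Phi M & forall J', Phi J' -> M `<=` J' -> J' `<=` M.
Proof.
move=> hn hPhi hJ.
(* The empty set is added to the family to bound the empty chain. *)
have [|M [hM Mmax]] := @Zorn_bigcup _ [set A | Phi A \/ A = set0].
  move=> C hC tC; set U := \bigcup_(X in C) X.
  have [[A [CA PA]]|noA] := pselect (exists A, C A /\ Phi A); last first.
    right; apply/seteqP; split=> // x [X CX Xx]; case: (hC _ CX) => [PX|X0].
      by apply: noA; exists X.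
    by rewrite -X0.
  left.
  have CPhi X x : C X -> X x -> Phi X.
    by move=> /hC[//|->].
  have finU (s : seq R) : (forall x, x \in s -> U x) ->
      exists X, [/\ C X, Phi X & forall x, x \in s -> X x].
    elim: s => [|x s IHs] hs; first by exists A.
    have [|X [CX PX sX]] := IHs.
      by move=> y ys; apply: hs; rewrite inE ys orbT.
    have [Y CY Yx] := hs x (mem_head _ _).
    case: (tC _ _ CX CY) => XY; [exists Y|exists X]; split=> //.
    - exact: CPhi CY Yx.
    - by move=> y; rewrite inE => /orP[/eqP->//|/sX/XY].
    - by move=> y; rewrite inE => /orP[/eqP->|/sX//]; apply: XY.
  have Uid : is_ideal U.
    apply/is_idealE; split; first by exists A => //; apply: ideal0; apply: hPhi.
    move=> a u v Uu Uv; have [|X [CX PX sX]] := finU [:: u; v].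
      by move=> y; rewrite !inE => /orP[]/eqP->.
    exists X => //; apply: idealD; first exact: hPhi.
      by apply: idealMl; [exact: hPhi|apply: sX; rewrite !inE eqxx].
    by apply: sX; rewrite !inE eqxx orbT.
  have [n [g Ug]] := hn U Uid.
  have [|X [CX PX sX]] := finU (codom g).
    by move=> _ /codomP[i ->]; rewrite Ug; apply: ideal_gen_range_id.
  suff -> : U = X by [].
  apply/seteqP; split; last by move=> x Xx; exists X.
  rewrite Ug; apply: smallest_sub; first exact: hPhi.
  by move=> _ [i _ <-]; apply: sX; apply: codom_f.
case: hM => [PM|M0].
  exists M => // J' PJ' MJ'; apply: contrapT => nJM.
  by apply: (Mmax J'); [split|left].
case: (Mmax J); last by left.
by rewrite M0; split=> // /(_ 0); apply; apply: ideal0; apply: hPhi.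
Qed.

(** This replaces localization at S: an ideal maximal among those containing J
    and disjoint from S is prime. *)
Lemma prime_avoiding S J :
  noetherian_ring R -> S 1 -> (forall x y, S x -> S y -> S (x * y)) ->
  is_ideal J -> (forall x, J x -> ~ S x) ->
  exists Q, [/\ prime_ideal Q, J `<=` Q & forall x, Q x -> ~ S x].
Proof.
move=> hn S1 SM hJ JS.
pose Phi := [set Q | [/\ is_ideal Q, J `<=` Q & forall x, Q x -> ~ S x]].
have [| |Q [hQ JQ QS] Qmax] := @noetherian_maximal Phi J hn.
- by move=> Q [].
- by split.
exists Q; split=> //; apply: prime_idealI => //; first by move=> /QS.
have meets u : ~ Q u -> exists q r, Q q /\ S (q + r * u).
  move=> nQu; apply: contrapT => noS.
  pose Qu := [set z | exists q r, Q q /\ z = q + r * u].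
  apply: nQu; apply: (Qmax Qu).
  - split; last by move=> _ [q [r [Qq ->]]] hS; apply: noS; exists q, r.
      apply/is_idealE; split.
        by exists 0, 0; rewrite mul0r addr0; split=> //; apply: ideal0.
      move=> a _ _ [q [r [Qq ->]]] [q' [r' [Qq' ->]]].
      exists (a * q + q'), (a * r + r'); split.
        by apply: idealD => //; apply: idealMl.
      by rewrite mulrDr mulrDl mulrA addrACA.
    move=> z /JQ Qz; exists z, 0.
    by rewrite mul0r addr0.
  - by move=> z Qz; exists z, 0; rewrite mul0r addr0.
  - by exists 0, 1; rewrite mul1r add0r; split=> //; apply: ideal0.
move=> x y Qxy; apply: contrapT => /not_orP[/meets[q [r [Qq Sx]]]].
move=> /meets[q' [r' [Qq' Sy]]].
apply: QS (SM _ _ Sx Sy); rewrite mulrDl; apply: idealD => //.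
  exact: idealMr.
rewrite mulrDr; apply: idealD => //; first exact: idealMl.
by rewrite mulrACA; apply: idealMl.
Qed.

(** If x lay in a minimal prime P, the multiplicative set of all s * x ^+ n
    with s outside P would not contain 0, and a prime disjoint from it would be
    strictly smaller than P. *)
Lemma nonzerodivisor_off_minimal_primes x :
  noetherian_ring R -> (forall z, z * x = 0 -> z = 0) ->
  off_minimal_primes x.
Proof.
move=> hn nzd P [hP Pmin] Px.
have Pid := prime_ideal_is_ideal hP.
pose S := [set z | exists s n, ~ P s /\ z = s * x ^+ n].
have [|||z|Q [hQ _ QS]] := @prime_avoiding S [set 0] hn.
- by exists 1, 0%N; rewrite mulr1; split=> //; apply: prime_ideal_proper.
- move=> _ _ [s [n [Ps ->]]] [s' [n' [Ps' ->]]].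
  exists (s * s'), (n + n')%N; rewrite mulrACA exprD; split=> //.
  by move=> /(prime_idealM hP)[].
- by apply/is_idealE; split=> // a _ _ -> ->; rewrite mulr0 addr0.
- move=> /= -> [s [n [nPs]]] /esym s0; apply: nPs.
  suff -> : s = 0 by apply: ideal0.
  elim: n s0 => [|n IHn]; first by rewrite mulr1.
  by rewrite exprSr mulrA => /nzd.
have QP : Q `<=` P.
  move=> z Qz; apply: contrapT => nPz; apply: (QS z Qz).
  by exists z, 0%N; rewrite mulr1.
apply: (QS x); first by rewrite (Pmin Q hQ QP).
by exists 1, 1%N; rewrite mul1r; split=> //; apply: prime_ideal_proper.
Qed.

(** Choose c in J with Ann (Ann c) maximal. An element v of J killed by c can be
    added to c: in a reduced ring Ann (c + v) is the intersection of Ann c and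
    Ann v, so v lies in Ann (Ann (c + v)) = Ann (Ann c), and v ^+ 2 = 0. Thus
    Ann c meets J trivially, and so it annihilates J. *)
Lemma nonzerodivisor_in_faithful_ideal J :
  noetherian_ring R -> reduced_ring R -> is_ideal J ->
  (forall z, (forall w, J w -> z * w = 0) -> z = 0) ->
  exists2 c, J c & forall z, z * c = 0 -> z = 0.
Proof.
move=> hn hred hJ faith.
pose AA x := [set w | forall z, z * x = 0 -> w * z = 0].
have AAid x : is_ideal (AA x).
  apply/is_idealE; split=> [z _|a u v hu hv z zx]; first by rewrite mul0r.
  by rewrite mulrDl -mulrA hu // hv // mulr0 addr0.
have [| |M [c [Jc McE]] cmax] :=
    @noetherian_maximal [set M | exists c, J c /\ M = AA c] (AA 0) hn.
- by move=> _ [c [_ ->]].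
- by exists 0; split=> //; apply: ideal0.
exists c => // z zc; apply: faith => w Jw; set v := z * w.
have Jv : J v by apply: idealMl.
have vc : v * c = 0 by rewrite /v mulrAC zc mul0r.
(* Since v * c = 0, multiplying by s * c isolates the square of s * c. *)
have annD s : s * (c + v) = 0 -> s * c = 0 /\ s * v = 0.
  move=> scv; have sc : s * c = 0.
    apply: (hred _ 2); rewrite expr2.
    have -> : s * c * (s * c) = s * (c + v) * (s * c).
      by rewrite mulrDr mulrDl (mulrACA s v) vc mulr0 addr0.
    by rewrite scv mul0r.
  by split=> //; move: scv; rewrite mulrDr sc add0r.
apply: (hred _ 2); rewrite expr2.
have : AA (c + v) `<=` M.
  apply: cmax; first by exists (c + v); split=> //; apply: idealD.
  by rewrite McE => u hu s /annD[/hu].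
move/(_ v); rewrite McE; apply=> //.
by move=> s /annD[_]; rewrite mulrC.
Qed.

End IdealTheory.

(** * Components in a graded algebra *)

Section GradedTheory.
Variables (F : fieldType) (R : comAlgType F) (G : nat -> set R).
Hypothesis hG : is_grading G.
Implicit Types (x y z w : R) (c : nat -> R) (D E : set nat) (I : set R).

Lemma submod_closedE (M : set R) :
  GRing.submod_closed (mem M) <->
  M 0 /\ forall (a : F) x y, M x -> M y -> M (a *: x + y).
Proof.
split=> -[h0 h]; split; rewrite ?in_setE in h0 *; rewrite ?inE //.
  by move=> a u v hu hv; have := h a u v; rewrite !inE; apply.
by move=> a u v; rewrite !inE; apply: h.
Qed.

Lemma grade0 n : G n 0.
Proof. by case: hG => _ /(_ n)/submod_closedE[]. Qed.

Lemma gradeZD n (a : F) x y : G n x -> G n y -> G n (a *: x + y).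
Proof. by case: hG => _ /(_ n)/submod_closedE[_ h] _ _ _; apply: h. Qed.

Lemma gradeM m n x y : G m x -> G n y -> G (m + n)%N (x * y).
Proof. by case: hG => _ _ h _ _; apply: h. Qed.

Lemma grade1 : G 0 1.
Proof. by case: hG => -> _ _ _ _; exists 1; rewrite ?scale1r. Qed.

Lemma gradeX n x m : G n x -> G (m * n)%N (x ^+ m).
Proof.
move=> Gx; elim: m => [|m IHm]; first exact: grade1.
by rewrite exprS mulSn; apply: gradeM.
Qed.

Lemma grade0_inv x : G 0 x -> x <> 0 -> exists u, u * x = 1.
Proof.
case: hG => -> _ _ _ _ [a _ <-] a0; exists (a^-1)%:A.
rewrite -scalerAl mul1r scalerA mulVf ?scale1r //.
by apply/eqP => a00; apply: a0; rewrite a00 scale0r.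
Qed.

(** The coefficients vanish from m on so that c is determined by x alone, even
    though m is not. *)
Definition decomposes c m x :=
  [/\ forall i, G i (c i), forall i, (m <= i)%N -> c i = 0 &
      x = \sum_(i < m) c i].

Lemma decomposes_widen c m m' x :
  decomposes c m x -> (m <= m')%N -> decomposes c m' x.
Proof.
move=> [Gc c0 ->] mm'; split=> // [i m'i|].
  by apply: c0; apply: leq_trans m'i.
rewrite -!(big_mkord xpredT) (big_cat_nat (n := m) (p := m')) //=.
rewrite [X in _ + X]big_nat_cond [X in _ + X]big1 ?addr0 // => i.
by rewrite andbT => /andP[/c0].
Qed.

Lemma decomposes_ex x : exists c m, decomposes c m x.
Proof.
case: hG => _ _ _ /(_ x)[m [c [Gc ->]]] _.
exists (fun i => if (i < m)%N then c i else 0), m; split.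
- by move=> i; case: ifP => _ //; apply: grade0.
- by move=> i; rewrite ltnNge => ->.
- by apply: eq_bigr => i _; rewrite ltn_ord.
Qed.

Lemma decomposesZD c m x c' m' y (a : F) :
  decomposes c m x -> decomposes c' m' y ->
  decomposes (fun i => a *: c i + c' i) (maxn m m') (a *: x + y).
Proof.
move=> /(@decomposes_widen _ _ (maxn m m'))/(_ (leq_maxl _ _))[Gc c0 ->].
move=> /(@decomposes_widen _ _ (maxn m m'))/(_ (leq_maxr _ _))[Gc' c0' ->].
split=> [i|i mi|]; first exact: gradeZD.
  by rewrite c0 // c0' // scaler0 addr0.
by rewrite scaler_sumr -big_split.
Qed.

Lemma decomposes_uniq c m c' m' x :
  decomposes c m x -> decomposes c' m' x -> c =1 c'.
Proof.
move=> hc hc' n; apply/eqP; rewrite -subr_eq0; apply/eqP.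
have := decomposesZD (-1) hc' hc; rewrite scaleN1r addNr.
move=> [Gd d0 /esym ds]; case: hG => _ _ _ _ /(_ _ _ Gd ds) dn.
have [nm|nm] := ltnP n (maxn m' m).
  by rewrite addrC -scaleN1r (dn n nm).
by rewrite addrC -scaleN1r (d0 n nm).
Qed.

Definition component n x : R :=
  xget 0 [set z | exists c m, decomposes c m x /\ z = c n].

Lemma componentE c m x n : decomposes c m x -> component n x = c n.
Proof.
move=> hc; rewrite /component; case: xgetP => [_ _ [c' [m' [hc' ->]]]|h].
  exact: decomposes_uniq hc' hc n.
by exfalso; apply: (h (c n)); exists c, m.
Qed.

Lemma component_grade n x : G n (component n x).
Proof.
have [c [m hc]] := decomposes_ex x; rewrite (componentE _ hc).
by case: hc.
Qed.

Lemma component_sum x : exists m, x = \sum_(i < m.+1) component i x.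
Proof.
have [c [m hc]] := decomposes_ex x; exists m.
case: (decomposes_widen hc (leqnSn m)) => _ _ {1}->.
by apply: eq_bigr => i _; rewrite (componentE _ hc).
Qed.

Lemma componentZD n (a : F) x y :
  component n (a *: x + y) = a *: component n x + component n y.
Proof.
have [[c [m hc]] [c' [m' hc']]] := (decomposes_ex x, decomposes_ex y).
by rewrite (componentE _ (decomposesZD a hc hc')) (componentE _ hc)
  (componentE _ hc').
Qed.

Lemma component_homog n m x :
  G m x -> component n x = if n == m then x else 0.
Proof.
move=> Gx; apply: (@componentE (fun i => if i == m then x else 0) m.+1).
split=> [i|i mi|].
- by case: eqP => [->|_] //; apply: grade0.
- by case: eqP => // im; rewrite im ltnn in mi.
- rewrite (bigD1 ord_max) //= eqxx big1 ?addr0 // => i.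
  by rewrite -val_eqE /= => /negbTE ->.
Qed.

Lemma component0 n : component n 0 = 0.
Proof. by rewrite (component_homog n (grade0 0)); case: ifP. Qed.

Lemma componentD n x y : component n (x + y) = component n x + component n y.
Proof. by rewrite -[x]scale1r componentZD !scale1r. Qed.

Lemma component_bigsum n r (h : 'I_r -> R) :
  component n (\sum_(i < r) h i) = \sum_(i < r) component n (h i).
Proof.
apply: (big_morph (component n)); [exact: componentD|exact: component0].
Qed.

Lemma componentM n j x w : G j w ->
  component n (x * w) = if (j <= n)%N then component (n - j) x * w else 0.
Proof.
move=> Gw; have [c [m hc]] := decomposes_ex x.
rewrite (componentE _ hc).
apply: (@componentE (fun i => if (j <= i)%N then c (i - j)%N * w else 0)
  (j + m)).
case: hc => Gc c0 ->; split=> [i|i jmi|].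
- case: leqP => [ji|_]; last exact: grade0.
  by rewrite -{1}(subnK ji); apply: gradeM.
- by case: leqP => // ji; rewrite c0 ?mul0r // leq_subRL.
- rewrite big_split_ord /= [X in X + _]big1 ?add0r; last first.
    by move=> i _; case: leqP => // ji; have := ltn_ord i; rewrite ltnNge ji.
  rewrite mulr_suml; apply: eq_bigr => i _.
  by rewrite leq_addr addKn.
Qed.

Lemma component0M x y : component 0 (x * y) = component 0 x * component 0 y.
Proof.
have [m {1}->] := component_sum y.
rewrite mulr_sumr component_bigsum big_ord_recl /=.
rewrite (componentM _ _ (component_grade 0 y)) /= big1 ?addr0 // => i _.
by rewrite (componentM _ _ (component_grade _ y)).
Qed.

Lemma degrees_in_grade D n x : D n -> G n x -> degrees_in G D x.
Proof. by move=> Dn Gx; apply: sub_gen_smallest; exists n. Qed.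

Lemma degrees_in_submod D : GRing.submod_closed (mem (degrees_in G D)).
Proof.
apply/submod_closedE; split=> [M [/submod_closedE[h0 _] _] //|a x y hx hy M hM].
by have [/submod_closedE[_ h] _] := hM; apply: h; [apply: hx|apply: hy].
Qed.

Lemma degrees_in_add D x y :
  degrees_in G D x -> degrees_in G D y -> degrees_in G D (x + y).
Proof.
case/submod_closedE: (degrees_in_submod D) => _ h hx hy.
by rewrite -[x]scale1r; apply: h.
Qed.

Lemma degrees_in_sum D n (h : 'I_n -> R) :
  (forall i, degrees_in G D (h i)) -> degrees_in G D (\sum_(i < n) h i).
Proof.
move=> hh; apply: big_ind => //; last exact: degrees_in_add.
by case/submod_closedE: (degrees_in_submod D).
Qed.

Lemma degrees_inP D x :
  degrees_in G D x <-> forall n, ~ D n -> component n x = 0.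
Proof.
split=> [|xD].
  apply: (smallest_sub (X := [set x | forall n, ~ D n -> component n x = 0])).
    apply/submod_closedE; split=> [n _|a u v hu hv n Dn].
      exact: component0.
    by rewrite componentZD hu // hv // scaler0 addr0.
  move=> z [n Dn Gz] m Dm; rewrite (component_homog _ Gz).
  by case: eqP => // mn; rewrite mn in Dm.
have [m ->] := component_sum x; apply: degrees_in_sum => i.
have [Di|/xD ->] := pselect (D i).
  by apply: degrees_in_grade Di (component_grade _ _).
by case/submod_closedE: (degrees_in_submod D).
Qed.

Lemma degrees_in_sub D E : D `<=` E -> degrees_in G D `<=` degrees_in G E.
Proof.
by move=> DE x /degrees_inP xD; apply/degrees_inP => n En; apply: xD => /DE.
Qed.

Lemma degrees_inM D E H x y :
  (forall i j, D i -> E j -> H (i + j)%N) ->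
  degrees_in G D x -> degrees_in G E y -> degrees_in G H (x * y).
Proof.
move=> DEH /degrees_inP xD /degrees_inP yE.
have h0 : degrees_in G H 0 by case/submod_closedE: (degrees_in_submod H).
have [[m ->] [m' ->]] := (component_sum x, component_sum y).
rewrite mulr_suml; apply: degrees_in_sum => i.
rewrite mulr_sumr; apply: degrees_in_sum => j.
have [Di|/xD ->] := pselect (D i); last by rewrite mul0r.
have [Ej|/yE ->] := pselect (E j); last by rewrite mulr0.
apply: degrees_in_grade (DEH _ _ Di Ej) _.
by apply: gradeM; apply: component_grade.
Qed.

Lemma degrees_in_ideal D :
  (forall i j, D i -> D (j + i)%N) -> is_ideal (degrees_in G D).
Proof.
move=> upD; apply/is_idealE; split=> [|a u v hu hv].
  by case/submod_closedE: (degrees_in_submod D).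
apply: degrees_in_add => //; apply: (@degrees_inM setT D) hu => //.
  by move=> i j _; apply: upD.
by apply/degrees_inP => n /(_ I).
Qed.

Lemma irrelevant_ideal_ideal : is_ideal (irrelevant_ideal G).
Proof. by apply: degrees_in_ideal => i j /= i0; rewrite addn_gt0 i0 orbT. Qed.

Lemma irrelevant_idealE x : irrelevant_ideal G x <-> component 0 x = 0.
Proof.
split=> [/degrees_inP|x0]; first exact.
by apply/degrees_inP => -[|n] // /(_ isT).
Qed.

(** R_+ is the kernel of the projection onto the field G 0, which is
    multiplicative. *)
Lemma irrelevant_ideal_prime : prime_ideal (irrelevant_ideal G).
Proof.
apply: prime_idealI; first exact: irrelevant_ideal_ideal.
  move=> /irrelevant_idealE; rewrite (component_homog _ grade1) /=.
  by move/eqP; rewrite oner_eq0.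
move=> x y /irrelevant_idealE; rewrite component0M => xy0.
have [x0|nx0] := pselect (component 0 x = 0).
  by left; apply/irrelevant_idealE.
right; apply/irrelevant_idealE.
have [u ux] := grade0_inv (component_grade 0 x) nx0.
by rewrite -[LHS]mul1r -ux -mulrA xy0 mulr0.
Qed.

Lemma component_homog_ideal r (g : 'I_r -> R) (gam : 'I_r -> nat) n x :
  (forall i, G (gam i) (g i)) ->
  ideal_gen (range g) x -> ideal_gen (range g) (component n x).
Proof.
move=> Gg /ideal_gen_rangeP[h ->]; rewrite component_bigsum.
have gI := ideal_gen_ideal (range g).
apply: ideal_sum => // i; rewrite (componentM _ _ (Gg i)).
case: ifP => _; last exact: ideal0.
by apply: (idealMl _ gI); apply: ideal_gen_range_id.
Qed.

Lemma ideal_of_components I D x :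
  is_ideal I -> (forall n z, D n -> G n z -> I z) -> degrees_in G D x -> I x.
Proof.
move=> hI GI /degrees_inP xD; have [m ->] := component_sum x.
apply: ideal_sum => // i; have [Di|/xD ->] := pselect (D i).
  exact: GI Di (component_grade _ _).
exact: ideal0.
Qed.

(** * Homogeneous parameters and high degrees *)

(** Induction on the sum of the exponents: write x = \sum_i h_i * g_i with h_i
    homogeneous. If m i = 0 then h_i * g_i already lies in the ideal of powers;
    otherwise h_i lies in the analogous ideal with m i lowered by one, and
    multiplying by g_i restores the exponent. The g_i may vanish or have
    degree 0. *)
Lemma pure_powers_contain r (g : 'I_r -> R) (gam : 'I_r -> nat) (B : nat) :
  (forall i, G (gam i) (g i)) ->
  (forall n x, (B <= n)%N -> G n x -> ideal_gen (range g) x) ->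
  forall (m : 'I_r -> nat) n x, (B + \sum_(i < r) m i * gam i <= n)%N ->
    G n x -> ideal_gen (range (fun i => g i ^+ (m i).+1)) x.
Proof.
move=> Gg GB m; have [N] := ubnP (\sum_(i < r) m i)%N.
elim: N m => // N IHN m mN n x Bn Gx.
set J := ideal_gen _; have hJ : is_ideal J by apply: ideal_gen_ideal.
have [|h xE] := @ideal_gen_rangeP _ _ g x.
  by apply: GB Gx; apply: leq_trans Bn; apply: leq_addr.
have -> : x = component n x by rewrite (component_homog _ Gx) eqxx.
rewrite xE component_bigsum; apply: ideal_sum => // i.
rewrite (componentM _ _ (Gg i)); case: leqP => [gn|_]; last exact: ideal0.
have [mi0|mi0] := posnP (m i).
  apply: (idealMl _ hJ).
  have := @ideal_gen_range_id _ _ (fun i => g i ^+ (m i).+1) i.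
  by rewrite mi0 expr1.
pose m' j := if j == i then (m i).-1 else m j.
have sumE (w : 'I_r -> nat) :
    (\sum_(j < r) m j * w j = w i + \sum_(j < r) m' j * w j)%N.
  rewrite (bigD1 i) //= [in RHS](bigD1 i) //= /m' eqxx addnA -mulSn prednK //.
  by congr (_ + _)%N; apply: eq_bigr => j /negbTE ->.
have Jm' z : ideal_gen (range (fun i => g i ^+ (m' i).+1)) z -> J (z * g i).
  move=> /ideal_gen_rangeP[e ->]; rewrite mulr_suml; apply: ideal_sum => // j.
  rewrite -mulrA; apply: (idealMl _ hJ).
  have Jj := @ideal_gen_range_id _ _ (fun i => g i ^+ (m i).+1) j.
  rewrite /m'; case: eqP => [ji|_]; last exact: (idealMr _ hJ).
  by rewrite prednK // ji -exprSr; rewrite ji in Jj.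
apply: Jm'; apply: (IHN m' _ (n - gam i)%N); last exact: component_grade.
  have := sumE (fun=> 1%N); rewrite -!big_distrl /= !muln1 add1n => sE.
  by move: mN; rewrite sE.
by rewrite leq_subRL // addnCA -sumE.
Qed.

(** Otherwise the multiplicative set of all w ^+ n * u with u outside R_+ misses
    (f): since (f) is homogeneous, the component of w ^+ n * u in degree n * j,
    which is w ^+ n times a unit, would have to lie in (f). A prime containing
    (f) and disjoint from that set is strictly contained in R_+, against
    dim R/(f) = 0. *)
Lemma sop_contains_powers r (f : 'I_r -> R) (delta : 'I_r -> nat) j w :
  noetherian_ring R -> (forall i, G (delta i) (f i)) ->
  krull_dim_quot (ideal_gen (range f)) 0 ->
  (0 < j)%N -> G j w -> exists n, ideal_gen (range f) (w ^+ n).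
Proof.
move=> hn Gf [_ dim0] j0 Gw; set J := ideal_gen (range f).
have hJ : is_ideal J by apply: ideal_gen_ideal.
have hm := irrelevant_ideal_prime.
apply: contrapT => noJ.
pose S := [set z | exists n u, ~ irrelevant_ideal G u /\ z = w ^+ n * u].
have n1 : ~ irrelevant_ideal G 1 by apply: prime_ideal_proper.
have [||||Q [hQ JQ QS]] := @prime_avoiding _ S J hn.
- by exists 0%N, 1; rewrite mulr1.
- move=> _ _ [n [u [nu ->]]] [n' [u' [nu' ->]]].
  exists (n + n')%N, (u * u'); rewrite mulrACA exprD; split=> //.
  by move=> /(prime_idealM hm)[].
- exact: hJ.
- move=> _ /[swap] -[n [u [nu ->]]] Jwu; apply: noJ; exists n.
  have [u0 u0E] : exists v, v * component 0 u = 1.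
    apply: grade0_inv (component_grade 0 u) _ => u0.
    exact/nu/irrelevant_idealE.
  have := component_homog_ideal (n * j) Gf Jwu.
  rewrite mulrC (componentM _ _ (gradeX n Gw)) leqnn subnn.
  by move=> /(idealMl u0 hJ); rewrite mulrA u0E mul1r.
have Qm : Q `<=` irrelevant_ideal G.
  move=> x Qx; apply: contrapT => nx; apply: (QS x Qx).
  by exists 0%N, x; rewrite mul1r.
apply: dim0; exists (fun i => if i is 0 then Q else irrelevant_ideal G); split.
  by move=> [|i] _ //=; split=> //; apply: subset_trans JQ Qm.
case=> // _; split=> // mQ; apply: (QS w).
  by apply: mQ; apply: degrees_in_grade Gw.
by exists 1%N, 1; rewrite mulr1.
Qed.

(** If all positive degrees vanished, R would be the field G 0, which has no
    chain of two primes. *)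
Lemma positive_dim_grade_neq0 d : krull_dim R d -> (0 < d)%N ->
  exists j w, [/\ (0 < j)%N, G j w & w <> 0].
Proof.
case=> -[c [cP clt]] _ d0; apply: contrapT => no.
have [_ nc] := clt 0%N d0; apply: nc => x c1x.
have [->|x0] := pselect (x = 0).
  exact: ideal0 (prime_ideal_is_ideal (cP 0%N isT)).
have [u ux] : exists u, u * x = 1.
  apply: grade0_inv x0; have [m xE] := component_sum x.
  rewrite xE big_ord_recl big1 ?addr0; first exact: component_grade.
  move=> i _; apply: contrapT => xi; apply: no.
  by exists (bump 0 i), (component (bump 0 i) x); split=> //;
    apply: component_grade.
have hc1 := cP 1%N d0.
case: (prime_ideal_proper hc1); rewrite -ux.
exact: idealMl (prime_ideal_is_ideal hc1) c1x.
Qed.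

(** R_+ is faithful: if z kills R_+ then its component in degree 0 kills w, so
    it is not a unit; hence z lies in R_+ and z ^+ 2 = 0. *)
Lemma nonzerodivisor_of_positive_degree :
  noetherian_ring R -> reduced_ring R ->
  (exists j w, [/\ (0 < j)%N, G j w & w <> 0]) ->
  exists2 c, irrelevant_ideal G c & forall z, z * c = 0 -> z = 0.
Proof.
move=> hn hred [j [w [j0 Gw w0]]].
apply: nonzerodivisor_in_faithful_ideal => //.
  exact: irrelevant_ideal_ideal.
move=> z zm; suff zI : irrelevant_ideal G z.
  by apply: (hred _ 2); rewrite expr2 zm.
apply/irrelevant_idealE; apply: contrapT => z0.
have [u uz] := grade0_inv (component_grade 0 z) z0.
have : z * w = 0 by apply: zm; apply: degrees_in_grade Gw.
move/(congr1 (component j)).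
rewrite (componentM _ _ Gw) leqnn subnn component0 => zw0.
by apply: w0; rewrite -[w]mul1r -uz -mulrA zw0 mulr0.
Qed.

Section Generators.
Variables (s : nat) (y : 'I_s -> R) (beta : 'I_s -> nat).
Hypothesis hy : algebra_generators y.
Hypothesis hbeta : forall i, G (beta i) (y i).

(* Generators of degree 0 are scalars and do not lie in R_+; replacing them by 0
   keeps the index type and the degrees beta. *)
Let g i := if (0 < beta i)%N then y i else 0.

Lemma positive_generators_grade i : G (beta i) (g i).
Proof. by rewrite /g; case: ifP => _ //; apply: grade0. Qed.

(** The elements of the form scalar + element of (g) make up a subalgebra that
    contains every y i, so they exhaust R; in positive degree the scalar drops
    out. *)
Lemma positive_generators_contain n x :
  (0 < n)%N -> G n x -> ideal_gen (range g) x.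
Proof.
move=> n0 Gx; have gI := ideal_gen_ideal (range g).
pose A := [set z : R | exists (a : F) h, ideal_gen (range g) h /\ z = a%:A + h].
have : A x.
  have : (setT : set R) x by [].
  rewrite -hy; apply: (smallest_sub (X := A)).
    split; first by rewrite inE; exists 1, 0; rewrite scale1r addr0;
      split=> //; apply: ideal0.
    - move=> a u v; rewrite !inE => -[b [h [hh ->]]] [b' [h' [hh' ->]]].
      exists (a * b + b'), (a *: h + h'); split.
        apply: (idealD gI) => //; rewrite -[h]mul1r scalerAl.
        exact: (idealMl _ gI).
      by rewrite scalerDr scalerDl scalerA addrACA.
    - move=> u v; rewrite !inE => -[b [h [hh ->]]] [b' [h' [hh' ->]]].
      exists (b * b'), (b%:A * h' + h * (b'%:A + h')); split.
        by apply: (idealD gI); [apply: (idealMl _ gI)|apply: (idealMr _ gI)].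
      by rewrite mulrDl mulrDr addrA -scalerAl mul1r scalerA.
  move=> _ [i _ <-]; have [bi|bi] := posnP (beta i).
    have := hbeta i; rewrite bi; case: hG => -> _ _ _ _ [a _ <-].
    by exists a, 0; rewrite addr0; split=> //; apply: ideal0.
  exists 0, (y i); rewrite scale0r add0r; split=> //.
  have := @ideal_gen_range_id _ _ g i.
  by rewrite {2}/g bi.
move=> [a [h [hh xE]]].
have -> : x = component n x by rewrite (component_homog _ Gx) eqxx.
rewrite xE componentD (@component_homog _ 0 a%:A); last first.
  by case: hG => -> _ _ _ _; exists a.
rewrite -[n == 0%N]negbK -lt0n n0 add0r.
exact: component_homog_ideal positive_generators_grade hh.
Qed.

Lemma irrelevant_ideal_min_degree b : (forall i, (b <= beta i)%N) ->
  irrelevant_ideal G `<=` degrees_in G [set n | (b <= n)%N].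
Proof.
move=> hb x; set D := [set n | (b <= n)%N].
have hD : is_ideal (degrees_in G D).
  by apply: degrees_in_ideal => i j /= bi; apply: leq_trans bi (leq_addl _ _).
apply: ideal_of_components => // n z n0 Gz.
have := positive_generators_contain n0 Gz.
apply: smallest_sub => // _ [i _ <-].
by apply: degrees_in_grade (positive_generators_grade i); apply: hb.
Qed.

(** The ideal (f) contains a power of each positive generator, so
    [pure_powers_contain] for these generators yields the bound B. *)
Lemma sop_contains_high_degrees r (f : 'I_r -> R) (delta : 'I_r -> nat) :
  noetherian_ring R -> (forall i, G (delta i) (f i)) ->
  krull_dim_quot (ideal_gen (range f)) 0 ->
  exists B, forall n x, (B <= n)%N -> G n x -> ideal_gen (range f) x.
Proof.
move=> hn Gf dim0; have hJ := ideal_gen_ideal (range f).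
have /choice[e he] i : exists e, ideal_gen (range f) (g i ^+ e.+1).
  rewrite /g; case: ifP => [bi|_]; last by exists 0%N; apply: ideal0.
  have [e he] := sop_contains_powers hn Gf dim0 bi (hbeta i).
  by exists e; rewrite exprS; apply: (idealMl _ hJ).
exists (1 + \sum_(i < s) e i * beta i)%N => n x Bn Gx.
have := pure_powers_contain positive_generators_grade
  positive_generators_contain Bn Gx.
by apply: smallest_sub => // _ [i _ <-].
Qed.

End Generators.

(** * Degrees bounded below by a real number *)

Section RealDegrees.
Variable K : realType.
Implicit Types (M N : K).

Lemma degrees_ge_sub M N :
  M <= N -> degrees_ge G N `<=` degrees_ge G M.
Proof. by move=> MN; apply: degrees_in_sub => n; apply: le_trans. Qed.

Lemma degrees_ge_ideal N : is_ideal (degrees_ge G N).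
Proof.
apply: degrees_in_ideal => i j /= Ni; apply: le_trans Ni _.
by rewrite ler_nat leq_addl.
Qed.

Lemma degrees_ge0 x : degrees_ge G (0 : K) x.
Proof. by apply/degrees_inP => n /(_ (ler0n _ _)). Qed.

Lemma degrees_geM M N x z :
  degrees_ge G M x -> degrees_ge G N z -> degrees_ge G (M + N) (x * z).
Proof. by apply: degrees_inM => i j Mi Nj /=; rewrite natrD lerD. Qed.

Lemma degrees_geX N x n : degrees_ge G N x -> degrees_ge G (n%:R * N) (x ^+ n).
Proof.
move=> Nx; elim: n => [|n IHn]; first by rewrite mul0r; apply: degrees_ge0.
by rewrite exprS -natr1 mulrDl mul1r addrC; apply: degrees_geM.
Qed.

Lemma degrees_ge_ideal_exp N I n :
  I `<=` degrees_ge G N -> ideal_exp I n `<=` degrees_ge G (n%:R * N).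
Proof.
move=> IN; elim: n => [|n IHn].
  by move=> x _; rewrite mul0r; apply: degrees_ge0.
apply: smallest_sub; first exact: degrees_ge_ideal.
move=> _ [u Iu [v /IHn hv <-]].
by rewrite -natr1 mulrDl mul1r addrC; apply: degrees_geM => //; apply: IN.
Qed.

End RealDegrees.
End GradedTheory.

(** * Tight closure and degrees *)

Theorem proposition4p14
  (K : realType) (F : fieldType) (p : nat) (R : comAlgType F)
  (G : nat -> set R)
  (hp : p \in [pchar F])
  (hG : is_grading G)
  (hnoeth : noetherian_ring R)
  (hred : reduced_ring R)
  (hequi : locally_equidimensional R)
  (s : nat) (y : 'I_s -> R) (beta : 'I_s -> nat)
  (hy : algebra_generators y)
  (hbeta : forall i, G (beta i) (y i))
  (beta' : nat)
  (hbeta'_attained : exists i, beta i = beta')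
  (hbeta'_min : forall i, (beta' <= beta i)%N)
  (a : set R)
  (ha_homog : homogeneous_ideal G a)
  (ha_primary : primary_ideal a)
  (ha_radical : ideal_radical a = irrelevant_ideal G)
  (l k : nat) (hlk : (l <= k)%N)
  (hka : ideal_exp (irrelevant_ideal G) k `<=` a)
  (hal : a `<=` ideal_exp (irrelevant_ideal G) l)
  (d : nat) (hd : (0 < d)%N)
  (f : 'I_d -> R) (delta : 'I_d -> nat)
  (hf : system_of_parameters f)
  (hdelta : forall i, G (delta i) (f i))
  (t : K) (ht : 0 < t)
  (htest : exists c : R, parameter_test_element p c) :
  let I := ideal_gen (range f) in
  let N : K := \sum_(i < d) (delta i)%:R - t * beta'%:R * l%:R in
  (forall x : R, degrees_ge G N x -> a_tight_closure p a t I x) /\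
  [set u + v | u in degrees_ge G N & v in a_frobenius_closure p a t I]
    `<=` a_tight_closure p a t I.
Proof.
move=> I N.
have [dimR dimQ] := hf.
have [B hB] := sop_contains_high_degrees hG hy hbeta hnoeth hdelta dimQ.
have [c0 mc0 nzd] := nonzerodivisor_of_positive_degree hG hnoeth hred
  (positive_dim_grade_neq0 hG dimR hd).
have p0 : (0 < p)%N by apply: prime_gt0; case/andP: hp.
(* The power c0 ^+ B lies in R_{>= B}, which pays for the B degrees that
   [pure_powers_contain] asks for beyond the sum of the (q - 1) * delta i. *)
have main x e z : degrees_ge G N x -> frobenius_exp p a t e z ->
    frobenius_power p I e (c0 ^+ B * x ^+ (p ^ e) * z).
  move=> Nx az; set q := (p ^ e)%N; have q0 : (0 < q)%N by rewrite expn_gt0 p0.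
  have mbeta : irrelevant_ideal G `<=` degrees_ge G (beta'%:R : K).
    move=> w /(irrelevant_ideal_min_degree hG hy hbeta hbeta'_min).
    by apply: degrees_in_sub => // n /=; rewrite ler_nat.
  have hz : degrees_ge G (t * q%:R * (l%:R * beta'%:R)) z.
    have : a `<=` degrees_ge G (l%:R * beta'%:R : K).
      by apply: (subset_trans hal); apply: degrees_ge_ideal_exp.
    move=> /(degrees_ge_ideal_exp hG)/(_ _ az); apply: degrees_ge_sub => //.
    (* Here t * q is bounded by its ceiling, the exponent of a. *)
    apply: ler_wpM2r; first by rewrite mulr_ge0.
    apply: le_trans (ceil_ge _) _.
    by rewrite natr_absz ler_int ler_norm.
  have hc : degrees_ge G (B%:R : K) (c0 ^+ B).
    rewrite -[B%:R]mulr1; apply: degrees_geX => //.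
    by move: mc0; apply: degrees_in_sub => // n /=; rewrite ler1n.
  have := degrees_geM hG (degrees_geM hG hc (degrees_geX hG (n := q) Nx)) hz.
  apply: ideal_of_components => //; first exact: ideal_gen_ideal.
  move=> n w /= degn Gw.
  have : ideal_gen (range (fun i => f i ^+ (q.-1).+1)) w.
    apply: (pure_powers_contain hG hdelta hB _ Gw).
    rewrite -(ler_nat K); apply: le_trans degn.
    rewrite natrD -addrA lerD2l /N mulrBr.
    have -> : q%:R * (t * beta'%:R * l%:R) = t * q%:R * (l%:R * beta'%:R).
      by rewrite -(mulrA t) mulrCA mulrA (mulrC beta'%:R).
    rewrite subrK -natr_sum -natrM ler_nat big_distrr /=.
    by apply: leq_sum => i _; rewrite leq_mul2r leq_pred orbT.
  apply: smallest_sub; first exact: ideal_gen_ideal.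
  move=> _ [i _ <-]; rewrite prednK //; apply: sub_gen_smallest.
  by exists (f i) => //; apply: ideal_gen_range_id.
have c0B : off_minimal_primes (c0 ^+ B).
  apply: nonzerodivisor_off_minimal_primes => // z.
  elim: B {hB main} => [|n IHn]; first by rewrite mulr1.
  by rewrite exprSr mulrA => /nzd.
split=> [x Nx|_ [u Nu [v [e0 hv] <-]]]; exists (c0 ^+ B) => //.
  by exists 0%N => e _ z; apply: main.
exists e0 => e e0e z az.
have pR : p \in [pchar R] by apply: (rmorph_pchar (in_alg R)).
rewrite exprDn_pchar; last by rewrite pnatX pnatE ?pR //; case/andP: pR.
rewrite mulrDr mulrDl.
have FI := ideal_gen_ideal [set r ^+ (p ^ e) | r in I].
apply: (idealD FI); first exact: main.
by rewrite -mulrA; apply: (idealMl _ FI); apply: hv.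
Qed.
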